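(* Let $E$ be a barrelled locally convex space with the Josefson--Nissenzweig property and let $X$ be a Tychonoff space containing an infinite compact set. Then $C_p(X,E)$ contains a complemented copy of $(c_0)_p$.
   Context: Locally convex spaces are real and Hausdorff. For a topological space $X$ and a locally convex space $E$, $C_p(X,E)$ is the space of all continuous functions $X\to E$ with the pointwise topology (inherited from the product $E^X$). Tychonoff means completely regular and Hausdorff. $(c_0)_p=\{x\in\mathbb{R}^\omega: x(n)\to 0\}$ with the topology inherited from the product $\mathbb{R}^\omega$. A locally convex space $G$ contains a complemented copy of $F$ if there are closed linear subspaces $G_1,G_2$ of $G$ with $G=G_1\oplus G_2$ algebraically, $G_1$ linearly homeomorphic to $F$, and the natural projection of $G$ onto $G_1$ continuous. A barrel in $E$ is a closed, absolutely convex, absorbing set; $E$ is barrelled if every barrel is a neighbourhood of $0$; a subset of $E$ is barrel-bounded if it is absorbed by every barrel in $E$. $\beta^*(E',E)$ is the topology on the topological dual $E'$ of uniform convergence on barrel-bounded subsets of $E$. $E$ has the Josefson--Nissenzweig property (JNP) if the identity map $(E',\sigma(E',E))\to(E',\beta^*(E',E))$ is not sequentially continuous, i.e. there is a weak$^*$ null sequence in $E'$ that does not converge to $0$ in $\beta^*(E',E)$. *)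

(* Defs.v *)
From HB Require Import structures.
From mathcomp Require Import all_boot all_order all_algebra.
From mathcomp Require Import all_classical all_reals all_analysis.

Set Implicit Arguments.
Unset Strict Implicit.
Unset Printing Implicit Defensive.

Import Order.TTheory GRing.Theory Num.Theory.
Import numFieldNormedType.Exports.

Local Open Scope classical_set_scope.
Local Open Scope ring_scope.
Local Open Scope convex_scope.

(** A [tvsType R] is locally convex by definition, but not Hausdorff: the
    Hausdorff axiom is a separate hypothesis wherever it is assumed. *)

Lemma cvg_initial (S : choiceType) (T : topologicalType) (f : S -> T)
    (F : set_system S) (s : S) : Filter F ->
  F --> (s : initial_topology f) <-> f @ F --> f s.
Proof.
move=> FF; split=> [Fs|Ffs].
  by apply: cvg_trans (@initial_continuous S T f s); exact: cvg_app.
move=> A /= [_ [[B Bop <-] Bfs sBA]].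
rewrite nbhs_filterE; apply: filterS sBA _; apply: Ffs.
exact: open_nbhs_nbhs.
Qed.

Section projective_topology.
Context (R : realType) (V : preTopologicalLmodType R) (I : Type).
Context (W : I -> tvsType R) (g : forall i, {linear V -> W i}).
Hypothesis cvgg : forall (F : set_system V) (v : V), Filter F ->
  F --> v <-> forall i, g i @ F --> g i v.

Let g_continuous i : continuous (g i).
Proof. by move=> v; have /cvgg := @cvg_id _ (nbhs v); exact. Qed.

Lemma projective_add_continuous : continuous (fun x : V * V => x.1 + x.2).
Proof.
move=> [x1 x2]; apply/cvgg => i /=; rewrite linearD.
suff : g i y.1 + g i y.2 @[y --> (x1, x2)] --> g i x1 + g i x2.
  by under eq_fun do rewrite -linearD.
have g1 : g i y.1 @[y --> (x1, x2)] --> g i x1.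
  exact: (cvg_comp (fun y : V * V => y.1) (g i) cvg_fst (@g_continuous i x1)).
have g2 : g i y.2 @[y --> (x1, x2)] --> g i x2.
  exact: (cvg_comp (fun y : V * V => y.2) (g i) cvg_snd (@g_continuous i x2)).
exact: (cvg_comp _ (fun y : W i * W i => y.1 + y.2) (cvg_pair g1 g2)
  (@add_continuous (W i) (g i x1, g i x2))).
Qed.

Lemma projective_scale_continuous :
  continuous (fun z : R^o * V => z.1 *: z.2).
Proof.
move=> [k x]; apply/cvgg => i /=; rewrite linearZ.
suff : y.1 *: g i y.2 @[y --> (k : R^o, x)] --> k *: g i x.
  by under eq_fun do rewrite -linearZ.
have g1 : y.1 @[y --> (k : R^o, x)] --> k by exact: cvg_fst.
have g2 : g i y.2 @[y --> (k : R^o, x)] --> g i x.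
  exact: (cvg_comp (fun y : R^o * V => y.2) (g i) cvg_snd (@g_continuous i x)).
exact: (cvg_comp _ (fun y : R^o * W i => y.1 *: y.2) (cvg_pair g1 g2)
  (@scale_continuous R (W i) (k, g i x))).
Qed.

Lemma projective_locally_convex : exists2 B : set_system V,
  (forall b, b \in B -> convex_set b) & basis B.
Proof.
exists [set U | open U /\ convex_set U]; first by move=> b /[!inE] -[].
split=> [b []//|v].
set D := [set U | _ /\ _].
have DF : Filter (filter_from D id).
  apply: filter_from_filter.
    by exists setT; split=> //; split; [exact: openT|move=> *; rewrite inE].
  move=> P Q [[oP cP] Pv] [[oQ cQ] Qv]; exists (P `&` Q) => //.
  split; last by split.
  split; first exact: openI.
  move=> x y l /[!inE] -[/mem_set Px /mem_set Qx] [/mem_set Py /mem_set Qy].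
  by split; apply/set_mem; [exact: cP|exact: cQ].
apply/cvgg => i A gA.
have [B Bc [Bo /(_ _ _ gA)[b [Bb bv] bA]]] := @locally_convex _ (W i).
exists (g i @^-1` b); last by move=> x; exact: bA.
split=> //; split.
  by apply: open_comp => // [x _|]; [exact: g_continuous|exact: Bo].
move=> x y l /set_mem xb /set_mem yb; apply/mem_set.
have -> : (g i @^-1` b) (x <| l |> y) =
    b ((g i x : convex_lmodType (W i)) <| l |> g i y).
  by congr b; rewrite [LHS](linearD (g i)) !linearZ.
by apply/set_mem; apply: Bc; apply/mem_set.
Qed.

End projective_topology.

Section ptws_tvs.
Context (R : realType) (U : Type) (E : tvsType R).

HB.instance Definition _ := GRing.Lmodule.copy {ptws U -> E} (U -> E).

Definition ptws_eval (u : U) (f : {ptws U -> E}) : E := f u.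

Let ptws_eval_is_linear u : linear (ptws_eval u).
Proof. by []. Qed.

HB.instance Definition _ u := GRing.isLinear.Build R {ptws U -> E} E _
  (ptws_eval u) (ptws_eval_is_linear u).

Let cvg_ptws_eval (F : set_system {ptws U -> E}) (f : {ptws U -> E}) :
  Filter F -> F --> f <-> forall u, ptws_eval u @ F --> ptws_eval u f.
Proof.
by move=> FF; split=> [/cvg_sup Ff u|Ff];
  [apply/cvg_initial; exact: Ff|apply/cvg_sup => u; exact/cvg_initial/Ff].
Qed.

HB.instance Definition _ := PreTopologicalNmodule_isTopologicalNmodule.Build
  {ptws U -> E} (projective_add_continuous cvg_ptws_eval).
HB.instance Definition _ := TopologicalNmodule_isTopologicalLmodule.Build
  R {ptws U -> E} (projective_scale_continuous cvg_ptws_eval).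
HB.instance Definition _ :=
  Uniform_isTvs.Build R {ptws U -> E} (projective_locally_convex cvg_ptws_eval).

End ptws_tvs.

Definition linear_subspace (R : realType) (V : lmodType R) (S : set V) : Prop :=
  submod_closed [in S].

(** The linear subspace [S] of [V], as a locally convex space of its own for
    the topology inherited from [V]. *)
Section subspace_tvs.
Context (R : realType) (V : tvsType R) (S : set V).

Definition mem_subtvs & linear_subspace S : {pred V} := [in S].

Context (hS : linear_subspace S).

HB.instance Definition _ := GRing.isSubmodClosed.Build R V (mem_subtvs hS)
  (GRing.submod_closed_semi hS).

Record subtvs := Subtvs { subtvs_val : V; _ : subtvs_val \in mem_subtvs hS }.

HB.instance Definition _ := [isSub for subtvs_val].
HB.instance Definition _ := [Choice of subtvs by <:].
HB.instance Definition _ := [SubChoice_isSubLmodule of subtvs by <:].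

HB.instance Definition _ :=
  Uniform.copy subtvs (initial_topology subtvs_val).

Let cvg_subtvs_val (F : set_system subtvs) (v : subtvs) : Filter F ->
  F --> v <-> forall _ : unit,
    (val : {linear subtvs -> V}) @ F --> (val : {linear subtvs -> V}) v.
Proof. by move=> FF; split=> [/cvg_initial//|/(_ tt) ?]; apply/cvg_initial. Qed.

HB.instance Definition _ := PreTopologicalNmodule_isTopologicalNmodule.Build
  subtvs (projective_add_continuous cvg_subtvs_val).
HB.instance Definition _ := TopologicalNmodule_isTopologicalLmodule.Build
  R subtvs (projective_scale_continuous cvg_subtvs_val).
HB.instance Definition _ :=
  Uniform_isTvs.Build R subtvs (projective_locally_convex cvg_subtvs_val).

End subspace_tvs.

Definition linearly_homeomorphic (R : realType) (E F : tvsType R) : Prop :=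
  exists (f : {linear E -> F}) (g : {linear F -> E}),
    [/\ cancel f g, cancel g f, continuous f & continuous g].

Definition contains_complemented_copy (R : realType) (G F : tvsType R) : Prop :=
  exists (G1 G2 : set G) (h1 : linear_subspace G1) (h2 : linear_subspace G2),
    [/\ closed G1 /\ closed G2,
        forall x, exists! p : subtvs h1 * subtvs h2, x = val p.1 + val p.2,
        linearly_homeomorphic (subtvs h1) F
      & exists2 p : G -> subtvs h1,
          forall (x1 : subtvs h1) (x2 : subtvs h2), p (val x1 + val x2) = x1
        & continuous p].

Section function_spaces.
Context (R : realType).

Lemma continuous_linear_subspace (X : topologicalType) (E : tvsType R) :
  linear_subspace [set f : {ptws X -> E} | continuous (f : X -> E)].
Proof.
split=> [|k f g /set_mem cf /set_mem cg]; apply/mem_set => x.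
  exact: cvg_cst.
have kf : k *: f y @[y --> x] --> k *: f x.
  exact: (cvg_comp _ (fun y : R^o * E => y.1 *: y.2)
    (cvg_pair (cvg_cst (k : R^o)) (cf x)) (@scale_continuous R E (k, f x))).
exact: (cvg_comp _ (fun y : E * E => y.1 + y.2)
  (cvg_pair kf (cg x)) (@add_continuous E (k *: f x, g x))).
Qed.

Definition Cp (X : topologicalType) (E : tvsType R) : tvsType R :=
  subtvs (continuous_linear_subspace X E).

Lemma c0_linear_subspace :
  linear_subspace [set x : {ptws nat -> R^o} | x n @[n --> \oo] --> (0 : R^o)].
Proof.
split=> [|k x y /set_mem cx /set_mem cy]; apply/mem_set => /=.
  exact: cvg_cst.
suff : k *: (x n : R^o) + y n @[n --> \oo] --> k *: (0 : R^o) + 0.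
  by rewrite scaler0 addr0.
by apply: cvgD => //; apply: cvgZ => //; exact: cvg_cst.
Qed.

Definition c0p : tvsType R := subtvs c0_linear_subspace.

End function_spaces.

Section barrels.
Context (R : realType) (E : tvsType R).

Definition balanced (A : set E) : Prop :=
  forall (a : R) x, `|a| <= 1 -> A x -> A (a *: x).

Definition absolutely_convex (A : set E) : Prop :=
  @convex_set R E A /\ balanced A.

Definition absorbs (A B : set E) : Prop :=
  exists2 r : R, 0 < r &
    forall a : R, r <= `|a| -> B `<=` [set a *: x | x in A].

Definition absorbing (A : set E) : Prop := forall x, absorbs A [set x].

Definition barrel (A : set E) : Prop :=
  [/\ closed A, absolutely_convex A & absorbing A].

Definition barrelled : Prop := forall A, barrel A -> nbhs (0 : E) A.

Definition barrel_bounded (B : set E) : Prop :=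
  forall A, barrel A -> absorbs A B.

Definition dual : set (E -> R^o) := [set f | linear f /\ continuous f].

(** [{ptws, _ --> _}] is convergence for the pointwise topology, which induces
    the weak* topology on [dual]; [{family barrel_bounded, _ --> _}] is
    convergence for the topology of uniform convergence on barrel-bounded
    sets, which induces [beta^*(E', E)] on [dual]. *)
Definition Josefson_Nissenzweig : Prop :=
  exists f : nat -> E -> R^o,
    [/\ forall n, dual (f n),
        {ptws, f n @[n --> \oo] --> (cst 0 : E -> R^o)}
      & ~ {family barrel_bounded, f n @[n --> \oo] --> (cst 0 : E -> R^o)}].

End barrels.

Definition tychonoff_space (X : topologicalType) : Prop :=
  completely_regular_space X /\ hausdorff_space X.

(* Main.v *)
Require Import Defs.
From HB Require Import structures.
From mathcomp Require Import all_boot all_order all_algebra.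
From mathcomp Require Import all_classical all_reals all_analysis.

(** The copy of [(c_0)_p] is the range of an explicit section of an explicit
    continuous linear map [Cp X E -> c0p R], both built from a biorthogonal
    pair in [E] and a sequence of bumps on [X].

    The Josefson-Nissenzweig property of [E] yields, after rescaling, a weak*
    null sequence [f_n] in [E'] and a barrel-bounded sequence [x_n] with
    [f_n x_n = 1] ([JNP_biorthogonal]).  An infinite compact set [K] has a limit
    point, so it contains points [k_n] with pairwise disjoint neighbourhoods
    [U_n] in [X] ([compact_infinite_disjoint_nbhs]); complete regularity gives
    continuous [phi_n : X -> [-1, 1]] vanishing off [U_n] with [phi_n k_n = 1].

    Put [T g = (f_n (g k_n))_n] and [S a = \sum_n a_n phi_n x_n].
    - [T g] is a null sequence: [E] being barrelled, the [f_n] are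
      equicontinuous, so they tend to [0] uniformly on the compact set [g(K)]
      ([barrelled_cvg_compact]).
    - [S a] is continuous: [a_n] tends to [0] and the [x_n] are absorbed by every
      barrel, hence by a basis of neighbourhoods of [0], so the tails of the
      series are uniformly small ([bump_sum_continuous]).
    - [S] is continuous for the pointwise topologies, because at each point of
      [X] at most one term of the series is non-zero.
    - [T (S a) = a], because [f_n (a_n x_n) = a_n].
    A continuous linear section splits its domain off as a complemented subspace
    ([retraction_complemented_copy]). *)

Set Implicit Arguments.
Unset Strict Implicit.
Unset Printing Implicit Defensive.

Import Order.TTheory GRing.Theory Num.Theory.
Import numFieldNormedType.Exports.

Local Open Scope classical_set_scope.
Local Open Scope ring_scope.

(** * Limits in locally convex spaces and their subspaces *)

Lemma hausdorff_separating (S : topologicalType) (I : Type)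
    (T : I -> topologicalType) (f : forall i, S -> T i) :
  (forall i, continuous (f i)) -> (forall i, hausdorff_space (T i)) ->
  (forall x y, (forall i, f i x = f i y) -> x = y) ->
  hausdorff_space S.
Proof.
move=> fc hT inj p q pq; apply: inj => i; apply: hT => A B Ap Bq.
have [z [Az Bz]] := pq _ _ (fc i p _ Ap) (fc i q _ Bq).
by exists (f i z).
Qed.

Section subtvs_topology.
Context (R : realType) (V : tvsType R) (S : set V) (hS : linear_subspace S).

Lemma subtvs_val_continuous : continuous (val : subtvs hS -> V).
Proof. exact: initial_continuous. Qed.

Lemma continuous_subtvs (T : topologicalType) (f : T -> subtvs hS) :
  continuous (val \o f) -> continuous f.
Proof. by move=> h x; apply/cvg_initial; exact: h. Qed.

End subtvs_topology.

Section pointwise_topology.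
Context (R : realType) (U : Type) (E : tvsType R).

Lemma continuous_ptws_tvs (T : topologicalType) (h : T -> {ptws U -> E}) :
  (forall u, continuous (fun t => h t u : E)) -> continuous h.
Proof. by move=> hc t; apply/cvg_sup => u; apply/cvg_initial; exact: hc. Qed.

Lemma ptws_tvs_eval_continuous (u : U) :
  continuous (fun f : {ptws U -> E} => (f u : E)).
Proof.
by move=> f; have /cvg_sup/(_ u)/cvg_initial := @cvg_id _ (nbhs f); exact.
Qed.

End pointwise_topology.

Section tvs_limits.
Context (R : realType) (E : tvsType R) (T : Type) (F : set_system T).
Context {FF : Filter F}.
Implicit Types (f g : T -> E) (k : T -> R^o) (a b : E) (c : R^o).

Lemma tvs_cvgD f g a b : f x @[x --> F] --> a -> g x @[x --> F] --> b ->
  f x + g x @[x --> F] --> a + b.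
Proof.
move=> fa gb; exact: (cvg_comp _ (fun z : E * E => z.1 + z.2)
  (cvg_pair fa gb) (@add_continuous E (a, b))).
Qed.

Lemma tvs_cvgB f g a b : f x @[x --> F] --> a -> g x @[x --> F] --> b ->
  f x - g x @[x --> F] --> a - b.
Proof.
move=> fa gb; exact: (cvg_comp _ (fun z : E * E => z.1 - z.2)
  (cvg_pair fa gb) (@sub_continuous E (a, b))).
Qed.

Lemma tvs_cvgZ k f c a : k x @[x --> F] --> c -> f x @[x --> F] --> a ->
  k x *: f x @[x --> F] --> c *: a.
Proof.
move=> kc fa; exact: (cvg_comp _ (fun z : R^o * E => z.1 *: z.2)
  (cvg_pair kc fa) (@scale_continuous R E (c, a))).
Qed.

End tvs_limits.

(** * Complemented copies from continuous linear sections *)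

Section retraction.
Context (R : realType) (G F : tvsType R).
Context (T : {linear G -> F}) (S : {linear F -> G}).
Hypotheses (Tc : continuous T) (Sc : continuous S) (ST : cancel S T).
Hypothesis hausG : hausdorff_space G.

Let G1 : set G := [set g | S (T g) = g].
Let G2 : set G := [set g | S (T g) = 0].

Let h1 : linear_subspace G1.
Proof.
split=> [|k f g /set_mem cf /set_mem cg]; apply/mem_set; rewrite /G1 /=.
  by rewrite !linear0.
by rewrite !linearP/= cf cg.
Qed.

Let h2 : linear_subspace G2.
Proof.
split=> [|k f g /set_mem cf /set_mem cg]; apply/mem_set; rewrite /G2 /=.
  by rewrite !linear0.
by rewrite !linearP/= cf cg scaler0 addr0.
Qed.

Let STc : continuous (fun g => S (T g)).
Proof. by move=> g; apply: continuous_comp; [exact: Tc|exact: Sc]. Qed.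

Let closed0 : closed [set (0 : G)].
Proof. exact/accessible_closed_set1/hausdorff_accessible. Qed.

Let in1 (a : F) : S a \in mem_subtvs h1.
Proof. by apply/mem_set; rewrite /G1/= ST. Qed.

Let in2 (g : G) : g - S (T g) \in mem_subtvs h2.
Proof. by apply/mem_set; rewrite /G2/= !linearB/= ST subrr. Qed.

Let to1 (a : F) : subtvs h1 := Subtvs (in1 a).

Let to1_linear : linear to1.
Proof. by move=> k a b; apply: val_inj; rewrite /= linearP. Qed.

HB.instance Definition _ := GRing.isLinear.Build R F (subtvs h1) _ to1
  to1_linear.

(** The idempotent [P = S \o T] splits [G] as the direct sum of its fixed points
    and its kernel, both closed as the zero sets of [P - id] and of [P]; [T] and
    [S] restrict to inverse homeomorphisms between the fixed points and [F]. *)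
Lemma retraction_complemented_copy : contains_complemented_copy G F.
Proof.
exists G1, G2, h1, h2; split.
- split.
    have -> : G1 = (fun g => S (T g) - g) @^-1` [set 0].
      apply/seteqP; split=> g /=; first by move=> ->; rewrite subrr.
      by move/eqP; rewrite subr_eq0 => /eqP.
    apply: closed_comp => // g _; apply: tvs_cvgB; [exact: STc|exact: cvg_id].
  by apply: (@closed_comp _ _ (fun g => S (T g)) [set 0]).
- move=> x; exists (to1 (T x), Subtvs (in2 x)); split.
    by rewrite /= addrC subrK.
  move=> [[p pP] [q qP]] /= xpq.
  have p1 := set_mem pP; have q2 := set_mem qP.
  have STx : S (T x) = p.
    by rewrite xpq !linearD/= (p1 : S (T p) = p) (q2 : S (T q) = 0) addr0.
  congr pair; apply: val_inj => /=; rewrite STx// xpq addrAC subrr add0r//.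
- exists (T \o (val : {linear subtvs h1 -> G})), to1; split.
  + by move=> x; apply: val_inj => /=; have := set_mem (valP x).
  + by move=> a /=; rewrite ST.
  + move=> x; apply: continuous_comp; last exact: Tc.
    exact: subtvs_val_continuous.
  + by apply: continuous_subtvs; exact: Sc.
- exists (to1 \o T) => [x1 x2|].
    apply: val_inj => /=; rewrite !linearD/=.
    have := set_mem (valP x1); have := set_mem (valP x2).
    by rewrite /G1 /G2/= => -> ->; rewrite addr0.
  by apply: continuous_subtvs; exact: STc.
Qed.

End retraction.

(** * Disjoint bumps along an infinite compact set *)

(** A cluster point of an injective sequence in [K]: such a sequence takes the
    value [z] at most once, so its tails reach every neighbourhood of [z] at
    points other than [z]. *)
Lemma compact_infinite_limit_point (X : topologicalType) (K : set X) :
  compact K -> infinite_set K -> exists2 z, K z & limit_point K z.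
Proof.
move=> Kc /infiniteP/card_leP[e0].
pose e (n : nat) : X := set_val (e0 (to_setT n)).
have eK n : K (e n) by exact: (set_valP (e0 (to_setT n))).
have einj m n : e m = e n -> m = n.
  move=> emn0; have emn := val_inj emn0.
  have := @inj _ _ setT e0 (to_setT m) (to_setT n).
  by move=> /(_ (mem_set I) (mem_set I) emn)/(congr1 set_val).
have [|z [Kz ez]] := Kc (e @ \oo) (fmap_proper_filter e eventually_filter).
  by exists 0%N => // n _; exact: eK.
exists z => // V zV.
have [N eN] : exists N, forall n, (N <= n)%N -> e n != z.
  have [[m emz]|noz] := pselect (exists m, e m = z).
    exists m.+1 => n mn; apply/eqP => enz.
    by move: mn; rewrite (einj n m) ?ltnn// enz.
  by exists 0%N => n _; apply/eqP => enz; apply: noz; exists n.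
have [|y [[n Nn <-] Vy]] := ez (e @` [set n | (N <= n)%N]) V _ zV.
  by exists N => // n /= Nn; exists n.
by exists (e n); split => //; exact: eN.
Qed.

(** A shrinking neighbourhood [V] of a limit point [z] of [K] always contains
    another point [y] of [K]; separating [y] from [z] inside [V] leaves a smaller
    neighbourhood of [z] in which to choose all later points. *)
Lemma compact_infinite_disjoint_nbhs (X : topologicalType) (K : set X) :
  hausdorff_space X -> compact K -> infinite_set K ->
  exists (k : nat -> X) (U : nat -> set X),
    [/\ forall n, K (k n), forall n, open_nbhs (k n) (U n)
      & trivIset setT U].
Proof.
move=> hX Kc Ki; have [z Kz lz] := compact_infinite_limit_point Kc Ki.
(* A stage of the construction: the chosen point, its neighbourhood, and the
   neighbourhood of [z] reserved for the later stages. *)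
pose J := {t : X * set X * set X | [/\ K t.1.1, open_nbhs t.1.1 t.1.2,
  open_nbhs z t.2 & t.1.2 `&` t.2 = set0]}.
have step (V : set X) : open_nbhs z V ->
    exists t : J, (sval t).1.2 `|` (sval t).2 `<=` V.
  move=> [Vo Vz]; have [y [yz Ky Vy]] := lz V (open_nbhs_nbhs (conj Vo Vz)).
  move: (hX); rewrite open_hausdorff => /(_ _ _ yz)[[P Q]/=].
  move=> [/set_mem Py /set_mem Qz] [Po Qo /eqP PQ].
  have tP : [/\ K y, open_nbhs y (V `&` P), open_nbhs z (V `&` Q)
      & (V `&` P) `&` (V `&` Q) = set0].
    split=> //; try by split=> //; exact: openI.
    by rewrite setIACA PQ setI0.
  by exists (exist _ (y, V `&` P, V `&` Q) tP) => x [] [].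
have [t0 _] := step setT (conj openT I).
have [|s [_ sS]] := @dependent_choice J
    (fun a b => (sval b).1.2 `|` (sval b).2 `<=` (sval a).2) _ t0.
  by move=> a; apply/cid; have [_ _ /step] := svalP a.
have sV m n : (m < n)%N -> (sval (s n)).1.2 `<=` (sval (s m)).2.
  move=> mn; have sub : forall j, (sval (s (m + j)%N)).2 `<=` (sval (s m)).2.
    elim=> [|j IH]; first by rewrite addn0.
    by rewrite addnS => x sx; apply/IH/sS; right.
  have -> : n = (m + (n - m.+1)).+1 by rewrite -addSn subnKC.
  by move=> x sx; apply: (sub (n - m.+1)%N); apply: sS; left.
have dis m n : (m < n)%N -> (sval (s m)).1.2 `&` (sval (s n)).1.2 = set0.
  move=> mn; apply/seteqP; split=> // x [xm /(sV _ _ mn) xn].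
  by have [_ _ _ <-] := svalP (s m).
exists (fun n => (sval (s n)).1.1), (fun n => (sval (s n)).1.2).
split=> [n|n|]; try by have [] := svalP (s n).
apply/trivIsetP => m n _ _; rewrite neq_lt => /orP[] mn; first exact: dis.
by rewrite setIC; exact: dis.
Qed.

Lemma tychonoff_bump (R : realType) (X : topologicalType) (k : X) (U : set X) :
  completely_regular_space X -> open_nbhs k U ->
  exists phi : X -> R^o, [/\ continuous phi, forall x, `|phi x| <= 1, phi k = 1
    & forall x, ~ U x -> phi x = 0].
Proof.
move=> crX [Uo Uk].
have /(crX k (~` U)) : closed (~` U) by exact: open_closedC.
move=> /(_ (fun h => h Uk))/(@uniform_separatorP _ R)[f [fc f01 fk fU]].
exists (fun x => 1 - f x : R^o); split.
- by move=> x; apply: cvgB; [exact: cvg_cst|exact: fc].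
- move=> x; have /= := f01 (f x) (ex_intro2 _ _ x I erefl).
  rewrite in_itv/= => /andP[f0 f1]; rewrite ger0_norm ?subr_ge0//.
  by rewrite lerBlDr lerDl.
- by rewrite (fk (f k)) ?subr0//; exists k.
- by move=> x nUx; rewrite (fU (f x)) ?subrr//; exists x.
Qed.

(** * Barrels *)

Section barrel_theory.
Context (R : realType) (E : tvsType R).

Lemma nbhs0_absorbing (A : set E) : nbhs 0 A -> absorbing A.
Proof.
move=> A0 x.
have : a *: x @[a --> (0 : R^o)] --> (0 : E).
  by rewrite -(scale0r x); apply: tvs_cvgZ; [exact: cvg_id|exact: cvg_cst].
move=> /(_ _ A0); rewrite -nbhs_ballE => -[d /= d0 dA].
exists (2 / d) => [|a da _ ->]; first by rewrite divr_gt0.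
have a0 : 0 < `|a| by apply: lt_le_trans da; rewrite divr_gt0.
exists (a^-1 *: x); last by rewrite scalerA divff ?scale1r// -normr_gt0.
apply: dA; rewrite -ball_normE/= sub0r normrN normfV.
rewrite -ltf_pV2 ?posrE ?invr_gt0// invrK (lt_le_trans _ da)//.
by rewrite -[ltLHS]mul1r ltr_pM2r ?invr_gt0// ltr1n.
Qed.

Lemma convex_setP (A : set E) : convex_set A <-> forall x y (l : R),
  0 <= l -> l <= 1 -> A x -> A y -> A (l *: x + (1 - l) *: y).
Proof.
split=> [cA x y l l0 l1 /mem_set Ax /mem_set Ay|cA x y l].
  exact/set_mem/(cA _ _ (Itv01 l0 l1) Ax Ay).
by move=> /set_mem Ax /set_mem Ay; apply/mem_set/cA.
Qed.

Lemma closure_convex (A : set E) : convex_set A -> convex_set (closure A).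
Proof.
move=> /convex_setP cA; apply/convex_setP => x y l l0 l1 Ax Ay N.
have : l *: p.1 + (1 - l) *: p.2 @[p --> (x, y)] --> l *: x + (1 - l) *: y.
  by apply: tvs_cvgD; apply: tvs_cvgZ; do ?exact: cvg_cst;
    [exact: cvg_fst|exact: cvg_snd].
move=> h /h[[P Q]/= [Px Qy] PQN].
have [x' [Ax' Px']] := Ax _ Px; have [y' [Ay' Qy']] := Ay _ Qy.
exists (l *: x' + (1 - l) *: y'); split; first exact: cA.
exact: (PQN (x', y')).
Qed.

Lemma closure_balanced (A : set E) : balanced A -> balanced (closure A).
Proof.
move=> bA a x a1 Ax N.
have : a *: y @[y --> x] --> a *: x.
  by apply: tvs_cvgZ; [exact: cvg_cst|exact: cvg_id].
by move=> h /h/Ax[y [Ay Ny]]; exists (a *: y); split => //; exact: bA.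
Qed.

Lemma convex_opp_balanced (A : set E) : convex_set A ->
  (forall x, A x -> A (- x)) -> A 0 -> balanced A.
Proof.
move=> /convex_setP cA AN A0.
have Apos (a : R) x : 0 <= a -> a <= 1 -> A x -> A (a *: x).
  by move=> a0 a1 Ax; have := cA x 0 a a0 a1 Ax A0; rewrite scaler0 addr0.
move=> a x a1 Ax; have [a0|a0] := leP 0 a.
  by apply: Apos => //; rewrite -(ger0_norm a0).
rewrite -[a]opprK scaleNr; apply: AN; apply: Apos => //.
  by rewrite oppr_ge0 ltW.
by rewrite -(ltr0_norm a0).
Qed.

(** Spaces of type [tvsType] are regular and have a basis of convex open sets:
    inside a neighbourhood whose closure lies in [W], take the closure of
    [C `&` - C] with [C] convex. *)
Lemma nbhs0_barrel (W : set E) : nbhs 0 W -> exists2 A, barrel A & A `<=` W.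
Proof.
move=> /uniform_regular[V V0 VW].
have [B Bc [Bo /(_ 0 V V0)[C [BC C0] CV]]] := @locally_convex _ E.
have Cc : convex_set C by apply: Bc; exact/mem_set.
have C0n : nbhs 0 C by apply: open_nbhs_nbhs; split => //; exact: Bo.
pose A := C `&` [set x | C (- x)].
have Ac : convex_set A.
  move/convex_setP : Cc => Cc.
  apply/convex_setP => x y l l0 l1 [Cx Cnx] [Cy Cny]; split; first exact: Cc.
  by rewrite /= opprD -!scalerN; exact: Cc.
have Ab : balanced A.
  apply: convex_opp_balanced => //.
    by move=> x [Cx Cnx]; split => //=; rewrite opprK.
  by split => //=; rewrite oppr0.
have An : nbhs 0 A.
  apply: filterI => //; have := @opp_continuous E 0.
  by rewrite /continuous_at oppr0 => /(_ C C0n).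
exists (closure A).
  split; first exact: closed_closure.
    by split; [exact: closure_convex|exact: closure_balanced].
  by apply/nbhs0_absorbing/(filterS _ An); exact: subset_closure.
by apply: subset_trans VW; apply: closureS => x [/CV].
Qed.

Lemma dualD (f : E -> R^o) (x y : E) : dual f -> f (x + y) = f x + f y.
Proof. by move=> [fl _]; have := fl 1 x y; rewrite !scale1r. Qed.

Lemma dualZ (f : E -> R^o) (a : R) (x : E) : dual f -> f (a *: x) = a * f x.
Proof.
move=> [fl _]; have f0 : f 0 = 0.
  by have := fl (-1) 0 0; rewrite scaler0 addr0 scaleN1r addNr.
by have := fl a x 0; rewrite f0 !addr0.
Qed.

Definition polar (f : nat -> E -> R^o) (e : R) : set E :=
  [set x | forall n, `|f n x| <= e].

(** Pointwise boundedness of the family is exactly what makes its polar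
    absorbing. *)
Lemma polar_barrel (f : nat -> E -> R^o) (e : R) : 0 < e ->
  (forall n, dual (f n)) -> (forall x, bounded_fun (f ^~ x)) ->
  barrel (polar f e).
Proof.
move=> e0 fd fb; have fZ n a x := dualZ a x (fd n).
have fD n x y := dualD x y (fd n).
split.
- have -> : polar f e = \bigcap_n [set x | `|f n x| <= e].
    by apply/seteqP; split=> x fx n; [move=> _|]; exact: fx.
  apply: closed_bigI => n _.
  apply: (@closed_comp _ _ (fun x => `|f n x|) [set r | r <= e]).
    by move=> x _; apply: cvg_norm; have [_] := fd n; exact.
  exact: closed_le.
- split.
    apply/convex_setP => x y l l0 l1 fx fy n; rewrite fD !fZ.
    rewrite (le_trans (ler_normD _ _))// !normrM.
    rewrite (ger0_norm l0) (@ger0_norm _ (1 - l)) ?subr_ge0//.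
    rewrite -[leRHS]mul1r -[in leRHS](subrK l 1) [leRHS]mulrDl addrC.
    by rewrite lerD// ler_wpM2l// subr_ge0.
  move=> a x a1 fx n; rewrite fZ normrM.
  by rewrite (le_trans _ (fx n))// ler_piMl.
- move=> x; have [M [_ fM]] := fb x.
  pose m := `|M| + 1; have m0 : 0 < m by rewrite ltr_wpDl.
  exists (m / e) => [|a ma _ ->]; first by rewrite divr_gt0.
  have a0 : 0 < `|a| by apply: lt_le_trans ma; rewrite divr_gt0.
  exists (a^-1 *: x); last by rewrite scalerA divff ?scale1r// -normr_gt0.
  move=> n; rewrite fZ normrM normfV ler_pdivrMl//.
  apply: (@le_trans _ _ m).
    by apply: fM => //; rewrite (le_lt_trans (ler_norm M))// ltrDl.
  by rewrite -ler_pdivrMr.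
Qed.

End barrel_theory.

(** * Weak* null sequences on a barrelled space *)

Section weak_star_null.
Context (R : realType) (E : tvsType R).
Implicit Types (f : nat -> E -> R^o).

Lemma barrelled_equicontinuous f (e : R) : barrelled E ->
  (forall n, dual (f n)) -> (forall x, f n x @[n --> \oo] --> (0 : R^o)) ->
  0 < e -> nbhs (0 : E) (polar f e).
Proof.
move=> bE fd f0 e0; apply: bE; apply: polar_barrel => // x.
by apply: cvg_seq_bounded; apply/cvg_ex; exists 0; exact: f0.
Qed.

(** Equicontinuity makes [f n \o g] small on a neighbourhood of each point,
    uniformly in large [n]; compactness of [K] then makes it small on all of [K],
    so the moving points [k n] do no harm. *)
Lemma barrelled_cvg_compact f (X : topologicalType) (K : set X) (g : X -> E)
    (k : nat -> X) : barrelled E ->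
  (forall n, dual (f n)) -> (forall x, f n x @[n --> \oo] --> (0 : R^o)) ->
  compact K -> continuous g -> (forall n, K (k n)) ->
  f n (g (k n)) @[n --> \oo] --> (0 : R^o).
Proof.
move=> bE fd f0 /compact_near_coveringP Kc gc kK.
apply/cvgr0Pnorm_lt => e e0.
pose P n y := `|f n (g y)| < e.
suff : \forall n \near \oo, K `<=` P n by apply: filterS => n; apply.
apply: Kc => x Kx.
have e2 : 0 < e / 2 by rewrite divr_gt0.
have gx : \forall y \near x, polar f (e / 2) (g y - g x).
  have : g y - g x @[y --> x] --> g x - g x.
    by apply: tvs_cvgB; [exact: gc|exact: cvg_cst].
  by rewrite subrr; apply; exact: barrelled_equicontinuous.
have fx : \forall n \near \oo, `|f n (g x)| < e / 2.
  by have /cvgr0Pnorm_lt := f0 (g x); apply.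
exists ([set y | polar f (e / 2) (g y - g x)],
  [set n | `|f n (g x)| < e / 2]) => //= -[y n] /= [py fxn].
rewrite /P -(subrK (g x) (g y)) (dualD _ _ (fd n)).
by rewrite (le_lt_trans (ler_normD _ _))// (splitr e) ler_ltD.
Qed.

(** Failure of uniform convergence on a barrel-bounded [B] gives [n_m >= m] and
    [x_m] in [B] with [`|f_(n_m) x_m|] bounded below by some [e > 0].  Dividing
    [f_(n_m)] by [f_(n_m) x_m] preserves weak* convergence to [0] because the
    divisors stay away from [0]. *)
Lemma JNP_biorthogonal : Josefson_Nissenzweig E ->
  exists f (x : nat -> E),
    [/\ forall n, dual (f n), forall y, f n y @[n --> \oo] --> (0 : R^o),
      forall n, f n (x n) = 1 & barrel_bounded (range x)].
Proof.
move=> [f [fd fw fb]].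
have f0 y : f n y @[n --> \oo] --> (0 : R^o).
  exact: (cvg_comp (f : nat -> {ptws E -> R^o}) (fun h => h y) fw
    (@ptws_tvs_eval_continuous R E R^o y (cst 0))).
have [B [bB [e e0 Be]]] : exists B, barrel_bounded B /\
    exists2 e : R, 0 < e &
      forall m, exists n, exists2 x, (m <= n)%N & B x /\ e <= `|f n x|.
  apply: contra_notP fb => nB; apply/fam_cvgP => B bB P /=.
  move=> /uniform_nbhs[U [+ UP]]; rewrite -entourage_ballE => -[e /= e0 eU].
  have [m fm] : exists m, forall n x, (m <= n)%N -> B x -> `|f n x| < e.
    apply: contra_notP nB => nm; exists B; split=> //; exists e => // m.
    apply: contra_notP nm => nm; exists m => n x mn Bx.
    by rewrite ltNge; apply/negP => efx; apply: nm; exists n, x.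
  exists m => // n /= mn; apply: UP => x Bx; apply: eU => /=.
  by rewrite -ball_normE /= sub0r normrN; exact: fm.
have /choice[s] : forall m, exists t : nat * E,
    [/\ (m <= t.1)%N, B t.2 & e <= `|f t.1 t.2|].
  by move=> m; have [n [x mn [Bx ex]]] := Be m; exists (n, x).
move=> /all_and3[s1 sB se].
pose c m := f (s m).1 (s m).2.
have c0 m : c m != 0 by rewrite -normr_gt0 (lt_le_trans e0)// se.
exists (fun m x => (c m)^-1 * f (s m).1 x), (fun m => (s m).2); split.
- move=> m; have fm := fd (s m).1; split.
    by move=> a u v; rewrite (dualD _ _ fm) (dualZ _ _ fm) mulrDr mulrCA.
  by move=> u; apply: cvgMr; have [_] := fm; exact.
- move=> y; apply/cvgr0Pnorm_lt => d d0.
  have /cvgr0Pnorm_lt/(_ (e * d)) := f0 y.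
  rewrite mulr_gt0// => /(_ isT)[N _ Nf].
  exists N => // m /= Nm; rewrite normrM normfV ltr_pdivrMl ?normr_gt0//.
  by rewrite (lt_le_trans (Nf _ (leq_trans Nm (s1 m))))// ler_pM2r//; exact: se.
- by move=> m; rewrite mulVf.
- move=> A /bB[r r0 rA]; exists r => // a ra _ [m _ <-].
  by apply: rA.
Qed.

End weak_star_null.

(** * The operators between [Cp X E] and [c0p R] *)

Section disjoint_bumps.
Context (R : realType) (E : tvsType R) (X : topologicalType).
Context (phi : nat -> X -> R^o) (x : nat -> E).
Hypotheses (phic : forall n, continuous (phi n))
  (phi1 : forall n y, `|phi n y| <= 1)
  (phi_disjoint : forall m n y, phi m y != 0 -> phi n y != 0 -> m = n)
  (xb : barrel_bounded (range x)).

Definition bump_index (y : X) : nat := xget 0%N [set n | phi n y != 0].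

(** The series [\sum_n a_n phi_n x_n], written through its only possibly
    non-zero term; this makes it visibly continuous and linear in [a] at each
    point. *)
Definition bump_sum (a : nat -> R^o) (y : X) : E :=
  (a (bump_index y) * phi (bump_index y) y) *: x (bump_index y).

Lemma bump_indexE n y : phi n y != 0 -> bump_index y = n.
Proof.
rewrite /bump_index => ny; case: xgetP => [m _ my|/(_ n)//].
exact: (phi_disjoint my ny).
Qed.

Lemma bump_eq0 n y : n != bump_index y -> phi n y = 0.
Proof. by apply: contraNeq => /bump_indexE ->. Qed.

Lemma bump_sum_partial (a : nat -> R^o) (y : X) (M : nat) :
  \sum_(n < M) (a n * phi n y) *: x n =
  if (bump_index y < M)%N then bump_sum a y else 0.
Proof.
case: ifPn => [yM|yM].
  rewrite (bigD1 (Ordinal yM))//= big1 ?addr0// => n nN.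
  by rewrite (@bump_eq0 n) ?mulr0 ?scale0r.
rewrite big1// => n _; rewrite (@bump_eq0 n) ?mulr0 ?scale0r//.
by apply: contraNneq yM => <-.
Qed.

Lemma bump_partial_continuous (a : nat -> R^o) (M : nat) :
  continuous (fun y => \sum_(n < M) (a n * phi n y) *: x n).
Proof.
elim: M => [|M IH] y.
  by under eq_fun do rewrite big_ord0; exact: cvg_cst.
under eq_fun do rewrite big_ord_recr/=.
apply: tvs_cvgD; first exact: IH.
apply: tvs_cvgZ; last exact: cvg_cst.
by apply: cvgMr; exact: phic.
Qed.

(** Inside a barrel [A] contained in [W] the term is [(a_n phi_n y r) z] with
    [z] in [A], where [r] is such that [r A] contains all the [x_n]; it suffices
    that [`|a_n| < r^-1]. *)
Lemma bump_tail_small (a : nat -> R^o) (W : set E) :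
  a n @[n --> \oo] --> (0 : R^o) -> nbhs 0 W ->
  exists M, forall y, (M <= bump_index y)%N -> W (bump_sum a y).
Proof.
move=> a0 /nbhs0_barrel[A bA AW].
have [_ [_ Ab] _] := bA; have [r r0 rA] := xb bA.
have /cvgr0Pnorm_lt/(_ r^-1) := a0; rewrite invr_gt0 => /(_ r0)[M _ Ma].
exists M => y /= yM; apply: AW.
have [|z Az /= zx] := rA r _ (x (bump_index y)) (ex_intro2 _ _ _ I erefl).
  by rewrite gtr0_norm.
rewrite /bump_sum -zx scalerA; apply: Ab => //.
rewrite !normrM (gtr0_norm r0) -ler_pdivlMr// mul1r.
by apply: le_trans (ltW (Ma _ yM)); rewrite ler_piMr.
Qed.

(** Near [y0] the sum is a continuous partial sum plus a tail.  The partial sum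
    is taken long enough to be exact at [y0] itself, so that only the tail at the
    nearby points has to be controlled. *)
Lemma bump_sum_continuous (a : nat -> R^o) :
  a n @[n --> \oo] --> (0 : R^o) -> continuous (bump_sum a).
Proof.
move=> a0 y0 O.
have := @add_continuous E (bump_sum a y0, 0); rewrite /continuous_at/= addr0.
move=> h /h[[P Q]/= [Py Q0] PQO].
have [M0 M0Q] := bump_tail_small a0 Q0.
pose M := maxn M0 (bump_index y0).+1.
have : \forall y \near y0, P (\sum_(n < M) (a n * phi n y) *: x n).
  have := @bump_partial_continuous a M y0.
  by rewrite /continuous_at bump_sum_partial leq_maxr => /(_ P Py).
apply: filterS => y; rewrite bump_sum_partial /=; case: ifPn => yM Py'.
  rewrite -[bump_sum a y]addr0.
  by apply: (PQO (_, _)); split=> //=; exact: nbhs_singleton.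
rewrite -[bump_sum a y]add0r; apply: (PQO (_, _)); split=> //=.
apply: M0Q; rewrite -leqNgt in yM; exact: leq_trans (leq_maxl _ _) yM.
Qed.

End disjoint_bumps.

Section operators.
Context (R : realType) (E : tvsType R) (X : topologicalType).

Lemma Cp_continuous (g : Cp X E) : continuous (val g : X -> E).
Proof. exact: (set_mem (valP g)). Qed.

Lemma c0p_cvg (a : c0p R) : val a n @[n --> \oo] --> (0 : R^o).
Proof. exact: (set_mem (valP a)). Qed.

Lemma Cp_eval_continuous (y : X) :
  continuous (fun g : Cp X E => (val g : X -> E) y).
Proof.
move=> g; exact: (cvg_comp _ (fun h : {ptws X -> E} => (h y : E))
  (@subtvs_val_continuous _ _ _ _ g) (@ptws_tvs_eval_continuous R X E y _)).
Qed.

Lemma c0p_coord_continuous (n : nat) :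
  continuous (fun a : c0p R => (val a : nat -> R^o) n).
Proof.
move=> a; exact: (cvg_comp _ (fun h : {ptws nat -> R^o} => (h n : R^o))
  (@subtvs_val_continuous _ _ _ _ a) (@ptws_tvs_eval_continuous R nat R^o n _)).
Qed.

Lemma hausdorff_Cp : hausdorff_space E -> hausdorff_space (Cp X E).
Proof.
move=> hE; apply: (@hausdorff_separating _ X (fun=> E)
  (fun y (g : Cp X E) => (val g : X -> E) y)) => // [y|g h gh].
  exact: Cp_eval_continuous.
by apply: val_inj; apply/funext.
Qed.

Section to_c0p.
Context (f : nat -> E -> R^o) (k : nat -> X).
Hypotheses (fd : forall n, dual (f n))
  (f0 : forall g : X -> E, continuous g ->
    f n (g (k n)) @[n --> \oo] --> (0 : R^o)).

Lemma sample_in (g : Cp X E) :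
  ((fun n => f n ((val g : X -> E) (k n))) : {ptws nat -> R^o}) \in
  mem_subtvs (@c0_linear_subspace R).
Proof. by apply/mem_set; apply: f0; exact: Cp_continuous. Qed.

Definition sample (g : Cp X E) : c0p R := Subtvs (sample_in g).

Lemma sample_is_linear : linear sample.
Proof.
move=> a g h; apply: val_inj; apply/funext => n /=.
by have [fl _] := fd n; exact: fl.
Qed.

Lemma sample_continuous : continuous sample.
Proof.
apply: continuous_subtvs; apply: continuous_ptws_tvs => n g.
have [_ fc] := fd n.
exact: (cvg_comp _ (f n) (@Cp_eval_continuous (k n) g) (fc _)).
Qed.

End to_c0p.

Section from_c0p.
Context (phi : nat -> X -> R^o) (x : nat -> E).
Hypothesis (Sc : forall a : nat -> R^o, a n @[n --> \oo] --> (0 : R^o) ->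
  continuous (bump_sum phi x a)).

Lemma spread_in (a : c0p R) :
  (bump_sum phi x (val a) : {ptws X -> E}) \in
  mem_subtvs (continuous_linear_subspace X E).
Proof. by apply/mem_set; apply: Sc; exact: c0p_cvg. Qed.

Definition spread (a : c0p R) : Cp X E := Subtvs (spread_in a).

Lemma spread_is_linear : linear spread.
Proof.
move=> c a b; apply: val_inj; apply/funext => y /=.
rewrite -[RHS]/(c *: bump_sum phi x (val a) y + bump_sum phi x (val b) y).
by rewrite /bump_sum scalerA -scalerDl mulrA -mulrDl.
Qed.

Lemma spread_continuous : continuous spread.
Proof.
apply: continuous_subtvs; apply: continuous_ptws_tvs => y a.
pose i := bump_index phi y.
have cc : {for a, continuous
    (fun b : c0p R => (val b : nat -> R^o) i * phi i y : R^o)}.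
  exact: (cvgMl (@c0p_coord_continuous i a)).
by apply: (tvs_cvgZ cc); exact: cvg_cst.
Qed.

End from_c0p.

End operators.

Theorem theorem6p2 (R : realType) (E : tvsType R) (X : topologicalType)
    (E_hausdorff : hausdorff_space E)
    (E_barrelled : barrelled E)
    (E_JNP : Josefson_Nissenzweig E)
    (X_tychonoff : tychonoff_space X)
    (X_compact : exists2 K : set X, compact K & infinite_set K) :
  contains_complemented_copy (Cp X E) (c0p R).
Proof.
have [crX hX] := X_tychonoff; have [K Kc Ki] := X_compact.
have [f [x [fd f0 fx xb]]] := JNP_biorthogonal E_JNP.
have [k [U [kK kU tU]]] := compact_infinite_disjoint_nbhs hX Kc Ki.
have /choice[phi] := fun n => @tychonoff_bump R X (k n) (U n) crX (kU n).
move=> /all_and4[phic phi1 phik phiU].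
have phi_disjoint m n y : phi m y != 0 -> phi n y != 0 -> m = n.
  move=> my ny; apply: tU => //; exists y; split; apply: contrapT.
    by move/phiU/eqP; rewrite (negbTE my).
  by move/phiU/eqP; rewrite (negbTE ny).
have Tc (g : X -> E) : continuous g ->
    f n (g (k n)) @[n --> \oo] --> (0 : R^o).
  by move=> gc; exact: barrelled_cvg_compact Kc gc kK.
have Sc := bump_sum_continuous phic phi1 phi_disjoint xb.
pose T : {linear Cp X E -> c0p R} := HB.pack (sample Tc)
  (GRing.isLinear.Build _ _ _ _ _ (sample_is_linear fd Tc)).
pose S : {linear c0p R -> Cp X E} := HB.pack (spread Sc)
  (GRing.isLinear.Build _ _ _ _ _ (spread_is_linear Sc)).
apply: (@retraction_complemented_copy R (Cp X E) (c0p R) T S).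
- exact: sample_continuous.
- exact: spread_continuous.
- move=> a; apply: val_inj; apply/funext => n /=.
  have kn : bump_index phi (k n) = n.
    by apply: bump_indexE => //; rewrite phik oner_neq0.
  by rewrite /bump_sum kn phik mulr1 (dualZ _ _ (fd n)) fx mulr1.
- exact: hausdorff_Cp.
Qed.
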